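(* Let $r,s,n$ be positive integers and let $\mathbb{F}_2[\mathbf{x}]$ be the polynomial ring over the field $\mathbb{F}_2$ in the $rsn$ variables $\mathbf{x}=\{x_{ijk}: i\in[r], j\in[s], k\in[n]\}$. Let $I_{r,s,n}$ be the ideal of $\mathbb{F}_2[\mathbf{x}]$ generated by the polynomials $x_{ijk}(x_{ijk}-1)$, $x_{ijk}x_{i'jk}$, $x_{ijk}x_{ij'k}$, $x_{ijk}x_{ijk'}$ for all $i\in[r]$, $j\in[s]$, $k\in[n]$, $i'\in\{i+1,\ldots,r\}$, $j'\in\{j+1,\ldots,s\}$, $k'\in\{k+1,\ldots,n\}$. Then the map sending a partial Latin rectangle $P=(p_{ij})\in\mathcal{R}_{r,s,n}$ to the point of $\mathbb{F}_2^{rsn}$ with coordinates $x_{ijk}=1$ if $p_{ij}=k$ and $x_{ijk}=0$ otherwise is a bijection from $\mathcal{R}_{r,s,n}$ onto the set $V(I_{r,s,n})$ of common zeros of $I_{r,s,n}$. Moreover, $|\mathcal{R}_{r,s,n}|=\dim_{\mathbb{F}_2}(\mathbb{F}_2[\mathbf{x}]/I_{r,s,n})$ and, for every integer $m\geq 0$, $|\mathcal{R}_{r,s,n:m}|=\mathrm{HF}_{\mathbb{F}_2[\mathbf{x}]/I_{r,s,n}}(m)$.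
   Context: An $r\times s$ partial Latin rectangle based on $[n]=\{1,\ldots,n\}$ is an $r\times s$ array in which each cell is either empty or contains a symbol of $[n]$, such that each symbol occurs at most once in each row and in each column; its size is its number of filled cells. $\mathcal{R}_{r,s,n}$ is the set of all such arrays and $\mathcal{R}_{r,s,n:m}$ its subset of those of size $m$. For an ideal $I$ of a polynomial ring $R$ and a term order $<$ (here the lexicographic order), the initial ideal $I_<$ is generated by the leading monomials of the nonzero elements of $I$; a standard monomial of $I$ is a monomial not in $I_<$. The Hilbert function $\mathrm{HF}_{R/I}(d)$ is the number of standard monomials of $I$ of degree $d$ (the dimension of the degree-$d$ component of $R/I_<$). *)

(* Defs.v *)
From HB Require Import structures.
From mathcomp Require Import all_boot all_order all_algebra.
From mathcomp Require Import boolp classical_sets functions.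
From mathcomp Require Import mpoly.

Set Implicit Arguments.
Unset Strict Implicit.
Unset Printing Implicit Defensive.

Import GRing.Theory.
Local Open Scope ring_scope.

Section PartialLatinRectangles.
Variables r s n : nat.

(* [None] is an empty cell. *)
Definition is_plr (P : 'M[option 'I_n]_(r, s)) : bool :=
  [forall k : 'I_n,
     [forall i : 'I_r, (#|[set j : 'I_s | P i j == Some k]| <= 1)%N]
  && [forall j : 'I_s, (#|[set i : 'I_r | P i j == Some k]| <= 1)%N]].

Definition plr_size (P : 'M[option 'I_n]_(r, s)) : nat :=
  #|[set ij : 'I_r * 'I_s | P ij.1 ij.2 != None]|.

Definition PLR : {set 'M[option 'I_n]_(r, s)} := [set P | is_plr P]%SET.

Definition PLR_size (m : nat) : {set 'M[option 'I_n]_(r, s)} :=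
  [set P in PLR | plr_size P == m]%SET.

End PartialLatinRectangles.

(* The [idealr] of the library are proper ideals; these may contain 1. *)
HB.mixin Record isMulAbsorbing (A : nzRingType) (S : A -> bool) := {
  mul_absorbing_subproof : forall a u, u \in S -> a * u \in S
}.

#[short(type="idealClosed")]
HB.structure Definition IdealClosed (A : nzRingType) :=
  {S of GRing.ZmodClosed A S & isMulAbsorbing A S}.

(* Membership in an ideal is undecidable in general, hence the use of the
   classical [`[< _ >]] to obtain the boolean predicate that the quotient
   construction requires. *)
Definition ideal_gen (A : comNzRingType) (G : set A) : {pred A} :=
  fun p => `[< exists2 s : seq (A * A),
                 forall x, x \in s -> G x.2 & p = \sum_(x <- s) x.1 * x.2 >].

Section IdealGen.
Variables (A : comNzRingType) (G : set A).

Lemma ideal_gen_mulr a u : u \in ideal_gen G -> a * u \in ideal_gen G.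
Proof.
move=> /asboolP[s sG ->]; apply/asboolP.
exists [seq (a * x.1, x.2) | x <- s] => [x /mapP[y /sG ? ->] //|].
by rewrite big_map mulr_sumr; apply: eq_bigr => x _; rewrite mulrA.
Qed.

Lemma ideal_gen_zmod_closed : zmod_closed (ideal_gen G).
Proof.
split=> [|p q Ip /(ideal_gen_mulr (-1))].
  by apply/asboolP; exists [::] => //; rewrite big_nil.
rewrite mulN1r => /asboolP[t tG ->]; move/asboolP: Ip => [s sG ->].
apply/asboolP; exists (s ++ t); last by rewrite big_cat.
by move=> x; rewrite mem_cat => /orP[/sG|/tG].
Qed.

HB.instance Definition _ :=
  GRing.isZmodClosed.Build A (ideal_gen G) ideal_gen_zmod_closed.
HB.instance Definition _ :=
  isMulAbsorbing.Build A (ideal_gen G) ideal_gen_mulr.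

End IdealGen.

(* The library endows [Quotient.quot I] with its additive structure only; the
   copy [quot_lmod I] also carries the K-module structure. *)
Section QuotientModule.
Variables (K : nzRingType) (A : algType K) (I : idealClosed A).

Definition quot_lmod := Quotient.quot I.
HB.instance Definition _ := GRing.Zmodule.on quot_lmod.

Definition quot_class (p : A) : quot_lmod :=
  (\pi_(Quotient.quot I) p)%qT.
Definition quot_scale (c : K) (x : quot_lmod) : quot_lmod :=
  quot_class (c *: repr (x : Quotient.quot I)).

Lemma quot_class_eqP p q : reflect (quot_class p = quot_class q) (p - q \in I).
Proof. by rewrite Quotient.idealrBE; apply: eqP. Qed.

Lemma quot_class_repr (x : quot_lmod) :
  quot_class (repr (x : Quotient.quot I)) = x.
Proof. exact: reprK. Qed.

Lemma quot_scaleE c p : quot_scale c (quot_class p) = quot_class (c *: p).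
Proof.
apply/quot_class_eqP; rewrite -scalerBr -mulr_algl.
by apply: mul_absorbing_subproof; apply/quot_class_eqP; exact: quot_class_repr.
Qed.

Lemma quot_classD p q : quot_class (p + q) = quot_class p + quot_class q.
Proof. exact: raddfD. Qed.

Fact quot_scaleA a b x : quot_scale a (quot_scale b x) = quot_scale (a * b) x.
Proof. by rewrite -[x]quot_class_repr !quot_scaleE scalerA. Qed.

Fact quot_scale1 : left_id 1 quot_scale.
Proof. by move=> x; rewrite -[x]quot_class_repr quot_scaleE scale1r. Qed.

Fact quot_scaleDr : right_distributive quot_scale +%R.
Proof.
move=> a x y; rewrite -[x]quot_class_repr -[y]quot_class_repr.
by rewrite -quot_classD !quot_scaleE -quot_classD scalerDr.
Qed.

Fact quot_scaleDl x : {morph quot_scale^~ x : a b / a + b}.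
Proof.
move=> a b; rewrite -[x]quot_class_repr !quot_scaleE.
by rewrite -quot_classD scalerDl.
Qed.

HB.instance Definition _ := GRing.Zmodule_isLmodule.Build K quot_lmod
  quot_scaleA quot_scale1 quot_scaleDr quot_scaleDl.

End QuotientModule.

Definition has_dim (K : fieldType) (V : lmodType K) (d : nat) : Prop :=
  exists b : 'I_d -> V,
    (forall v, exists c : 'I_d -> K, v = \sum_i c i *: b i) /\
    (forall c : 'I_d -> K, \sum_i c i *: b i = 0 -> forall i, c i = 0).

Section InitialIdeals.
Variables (K : fieldType) (N : nat).
Implicit Types (le : rel 'X_{1..N}) (I : {pred {mpoly K[N]}}).

(* Pure lexicographic order with 'X_0 > 'X_1 > ... > 'X_(N-1). The order that
   the multinomials library puts on 'X_{1..N} is graded, hence not used here. *)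
Definition lex_le : rel 'X_{1..N} := fun m1 m2 =>
  (m1 == m2) ||
  [exists i : 'I_N, (m1 i < m2 i)%N &&
     [forall j : 'I_N, (j < i)%N ==> (m1 j == m2 j)]].

Definition is_lead_monom le (p : {mpoly K[N]}) (m : 'X_{1..N}) : Prop :=
  m \in msupp p /\ forall m', m' \in msupp p -> le m' m.

Definition initial_ideal le I : {pred {mpoly K[N]}} :=
  ideal_gen [set q | exists p m,
    [/\ p \in I, p != 0, is_lead_monom le p m & q = 'X_[m]]]%classic.

Definition standard_monom le I (m : 'X_{1..N}) : bool :=
  'X_[m] \notin initial_ideal le I.

Definition hilbert_function le I (d : nat) : nat :=
  #|[set m : 'X_{1..N < d.+1} | (mdeg m == d) && standard_monom le I m]|.

End InitialIdeals.

Section PLRIdeal.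
Variables r s n : nat.

Definition cells : finType := ('I_r * 'I_s * 'I_n)%type.

(* The r * s * n variables are numbered by the enumeration of the index triples,
   which is lexicographic: x_ijk comes before x_i'j'k' when (i,j,k) is
   lexicographically smaller than (i',j',k'). *)
Definition xvar (i : 'I_r) (j : 'I_s) (k : 'I_n) : {mpoly 'F_2[#|cells|]} :=
  'X_(enum_rank ((i, j, k) : cells)).

Inductive plr_generator : {mpoly 'F_2[#|cells|]} -> Prop :=
| gen_bool (i : 'I_r) (j : 'I_s) (k : 'I_n) :
    plr_generator (xvar i j k * (xvar i j k - 1))
| gen_col (i i' : 'I_r) (j : 'I_s) (k : 'I_n) of (i < i')%N :
    plr_generator (xvar i j k * xvar i' j k)
| gen_row (i : 'I_r) (j j' : 'I_s) (k : 'I_n) of (j < j')%N :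
    plr_generator (xvar i j k * xvar i j' k)
| gen_cell (i : 'I_r) (j : 'I_s) (k k' : 'I_n) of (k < k')%N :
    plr_generator (xvar i j k * xvar i j k').

Definition plr_ideal : idealClosed {mpoly 'F_2[#|cells|]} :=
  ideal_gen plr_generator.

Definition zeros (I : {pred {mpoly 'F_2[#|cells|]}}) : set {ffun cells -> 'F_2} :=
  [set a | forall p, p \in I -> p.@[fun v => a (enum_val v)] = 0]%classic.

Definition plr_point (P : 'M[option 'I_n]_(r, s)) : {ffun cells -> 'F_2} :=
  [ffun x : cells => (P x.1.1 x.1.2 == Some x.2)%:R].

End PLRIdeal.

(* Main.v *)
(* Partial Latin rectangles are the independent sets S of a graph on the cells
   (i, j, k), and the ideal is I = (x_u^2 - x_u, x_u x_v : u ~ v). Modulo I every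
   monomial equals the squarefree monomial x^S on its support S, which lies in I
   unless S is independent. Conversely, for S independent, the linear form that
   sums the coefficients of all monomials of support exactly S vanishes on I.
   Hence the x^S with S independent form a basis of the quotient; they are also
   the standard monomials, since x^S is the lexicographically least monomial of
   support S. *)
Require Import Defs.
From mathcomp Require Import all_boot all_order all_algebra.
From mathcomp Require Import boolp classical_sets functions.
From mathcomp Require Import mpoly zify.

Set Implicit Arguments.
Unset Strict Implicit.
Unset Printing Implicit Defensive.

Import GRing.Theory.
Local Open Scope ring_scope.

(** * Membership in a generated ideal *)

Section IdealGenMembership.
Variables (A : comNzRingType) (G : set A).

Lemma mem_ideal_gen g : G g -> g \in ideal_gen G.
Proof.
move=> Gg; apply/asboolP; exists [:: (1, g)]; last by rewrite big_seq1 mul1r.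
by move=> x; rewrite inE => /eqP->.
Qed.

Lemma ideal_gen_annihil (B : comNzRingType) (f : {rmorphism A -> B}) :
  (forall g, G g -> f g = 0) -> forall p, p \in ideal_gen G -> f p = 0.
Proof.
move=> fG p /asboolP[t tG ->]; rewrite rmorph_sum big1_seq // => x /andP[_ xt].
by rewrite rmorphM (fG _ (tG _ xt)) mulr0.
Qed.

End IdealGenMembership.

(** * Supports of monomials, 0/1 points and the lexicographic order *)

Section MonomialSupport.
Variables (K : fieldType) (N : nat).
Implicit Types (m : 'X_{1..N}) (S T : {set 'I_N}).

Definition mnm_supp m : {set 'I_N} := [set i | m i != 0%N]%SET.

Lemma mnm_supp_mesym1 S : mnm_supp (mesym1 S) = S.
Proof. by apply/setP => i; rewrite inE mnmE; case: (i \in S). Qed.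

Lemma mesym1_mnm_supp m : (forall i, m i <= 1)%N -> mesym1 (mnm_supp m) = m.
Proof.
by move=> m_le1; apply/mnmP => i; rewrite mnmE inE; case: (m i) (m_le1 i) => [|[]].
Qed.

Lemma mesym1_supp_le m : (mesym1 (mnm_supp m) <= m)%MM.
Proof. by apply/mnm_lepP => i; rewrite mnmE inE; case: (m i). Qed.

Definition indicator S : 'I_N -> K := fun i => (i \in S)%:R.

(** At a 0/1 point a monomial takes the value 1 if its support lies in [S], and 0 otherwise. *)
Lemma meval_indicator (p : {mpoly K[N]}) S :
  p.@[indicator S] = \sum_(m <- msupp p | mnm_supp m \subset S) p@_m.
Proof.
rewrite mevalE [RHS]big_mkcond /=; apply: eq_bigr => m _.
case: ifPn => [/fintype.subsetP sub | /subsetPn[i]].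
  rewrite big1 ?mulr1 // => i _; rewrite /indicator.
  case: (boolP (i \in S)) => [_|iS]; first by rewrite expr1n.
  have := contra (sub i) iS; rewrite inE negbK => /eqP->; exact: expr0.
rewrite inE => mi iS; rewrite (bigD1 i) //= /indicator (negPf iS).
by rewrite expr0n (negPf mi) mul0r mulr0.
Qed.

Lemma lex_le_antisym m1 m2 : lex_le m1 m2 -> (m2 <= m1)%MM -> m1 = m2.
Proof.
move=> /orP[/eqP//|/existsP[i /andP[lt_i _]]] /mnm_lepP /(_ i).
by rewrite leqNgt lt_i.
Qed.

(** The least index where the exponents differ decides the comparison, and divisibility fixes its
    direction. *)
Lemma lex_le_mnm m1 m2 : (m1 <= m2)%MM -> lex_le m1 m2.
Proof.
move=> /mnm_lepP le12; rewrite /lex_le; case: eqVneq => //= neq12.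
have [i0 neq_i0] : exists i, m1 i != m2 i.
  apply/existsP; rewrite -negb_forall; apply: contraNN neq12 => /forallP eq12.
  by apply/eqP/mnmP => i; apply/eqP.
case: (arg_minnP (P := fun i => m1 i != m2 i) (fun i : 'I_N => i : nat) neq_i0).
move=> i neq_i min_i; apply/existsP; exists i.
rewrite ltn_neqAle neq_i le12; apply/forallP => j; apply/implyP => lt_ji.
by apply: contraTT lt_ji => /min_i; rewrite -leqNgt.
Qed.

End MonomialSupport.

(** * The ideal of independent sets of a graph: zeros, standard monomials, quotient *)

Section IndependenceIdeal.
Variables (K : fieldType) (N : nat) (e : rel 'I_N).
Implicit Types (m : 'X_{1..N}) (S T : {set 'I_N}) (p : {mpoly K[N]}).

Inductive indep_generator : {mpoly K[N]} -> Prop :=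
| indep_gen_bool i : indep_generator ('X_i * ('X_i - 1))
| indep_gen_edge i j of e i j : indep_generator ('X_i * 'X_j).

Let I : idealClosed {mpoly K[N]} := ideal_gen indep_generator.

(** Each pair is tested in both orders, so [e] may be an oriented edge relation. *)
Definition indep S := [forall i in S, forall j in S, ~~ e i j].

Lemma indepP S : reflect {in S &, forall i j, ~~ e i j} (indep S).
Proof.
apply: (iffP forall_inP) => [indS i j iS jS | indS i iS].
  exact: (forall_inP (indS i iS)).
by apply/forall_inP => j jS; apply: indS.
Qed.

Lemma indep_sub S T : S \subset T -> indep T -> indep S.
Proof. by move=> /fintype.subsetP ST /indepP iT; apply/indepP => i j /ST iS /ST; apply: iT. Qed.

Lemma indep_ideal_zeroP (v : 'I_N -> K) :
  (forall p, p \in I -> p.@[v] = 0) <->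
  (forall i, (v i == 0) || (v i == 1)) /\ indep [set i | v i != 0]%SET.
Proof.
split=> [v0 | [v01 /indepP indv]].
  split=> [i|].
    have := v0 _ (mem_ideal_gen (indep_gen_bool i)).
    by rewrite rmorphM rmorphB rmorph1 /= mevalXU => /eqP; rewrite mulf_eq0 subr_eq0.
  apply/indepP => i j; rewrite !inE => vi vj; apply/negP => eij.
  have /eqP := v0 _ (mem_ideal_gen (indep_gen_edge eij)).
  by rewrite rmorphM /= !mevalXU mulf_eq0 (negPf vi) (negPf vj).
apply: (@ideal_gen_annihil _ _ _ (meval v)) => _ [i | i j eij].
  rewrite rmorphM rmorphB rmorph1 /= mevalXU; apply/eqP.
  by rewrite mulf_eq0 subr_eq0.
rewrite rmorphM /= !mevalXU; apply/eqP; rewrite mulf_eq0.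
by apply: contraTT eij => /norP[vi vj]; apply: indv; rewrite inE.
Qed.

Lemma indicator_zero S : indep S -> forall p, p \in I -> p.@[indicator K S] = 0.
Proof.
move=> indS; apply/indep_ideal_zeroP; split=> [i|].
  by rewrite /indicator; case: (i \in S); rewrite eqxx ?orbT.
rewrite (_ : [set i | _]%SET = S) //.
by apply/setP => i; rewrite inE /indicator; case: (i \in S); rewrite ?oner_eq0 ?eqxx.
Qed.

(* Evaluating at the indicator of T sums the coefficients of the monomials
   supported in T, so the sum over those of support exactly T vanishes by
   induction on T. *)
Lemma support_coef_sum0 p S : p \in I -> indep S ->
  \sum_(m <- msupp p | mnm_supp m == S) p@_m = 0.
Proof.
move=> pI; have [k] := ubnP #|S|; elim: k S => // k IHk S ltSk indS.
have := indicator_zero indS pI.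
rewrite meval_indicator (bigID (fun m => mnm_supp m == S)) /=.
rewrite [X in _ + X](partition_big (@mnm_supp N) (fun U => U \proper S)) /=; last first.
  by move=> m; rewrite finset.properEneq andbC.
rewrite [X in _ + X]big1 ?addr0 => [sum0 | U US].
  by rewrite -[RHS]sum0; apply: eq_bigl => m; case: eqP => [->|]; rewrite ?subxx ?andbF.
rewrite -[RHS](IHk U) //; first last.
- by apply: indep_sub indS; apply: proper_sub.
- by apply: leq_trans (proper_card US) _.
apply: eq_bigl => m; case: (eqVneq (mnm_supp m) U) => [->|]; last by rewrite andbF.
by rewrite andbT andbC -finset.properEneq.
Qed.

(** If no other monomial of [p] has support [S], the vanishing sum of [support_coef_sum0] has at
    most this one term. Both the leading monomials and the linear independence in the quotient rest
    on this. *)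
Lemma mcoeff_mesym1_eq0 p S : p \in I -> indep S ->
  (forall m, m \in msupp p -> mnm_supp m = S -> m = mesym1 S) ->
  p@_(mesym1 S) = 0.
Proof.
move=> pI indS uniqS; have := support_coef_sum0 pI indS.
have [Sp | /memN_msupp_eq0 //] := boolP (mesym1 S \in msupp p).
rewrite (big_rem _ Sp) /= mnm_supp_mesym1 eqxx big1_seq ?addr0 // => m.
rewrite mem_rem_uniq ?msupp_uniq // inE => /andP[/eqP mS /andP[neq mp]].
by rewrite (uniqS _ mp mS) eqxx in neq.
Qed.

(** An exponent of at least 2 lets $x_i(x_i-1)$ be factored out of the difference. *)
Lemma mpolyX_sub_ideal m i : (1 < m i)%N -> 'X_[m] - 'X_[m - U_(i)] \in I.
Proof.
move=> m_i; have le_mi: (U_(i) + U_(i) <= m)%MM.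
  by apply/mnm_lepP => j; rewrite mnmDE mnm1E; case: eqP => [<-|].
have -> : 'X_[m] - 'X_[m - U_(i)] =
          'X_[m - (U_(i) + U_(i))] * ('X_i * ('X_i - 1)) :> {mpoly K[N]}.
  rewrite !mulrBr mulr1 -!mpolyXD submK //; congr (_ - 'X_[_]).
  by apply/mnmP => j; move/mnm_lepP/(_ j): le_mi; rewrite !(mnmBE, mnmDE) => ?; lia.
exact/mul_absorbing_subproof/mem_ideal_gen/indep_gen_bool.
Qed.

(** Induction on the degree: lowering an exponent above 1 by one stays in the same class and keeps
    the support. *)
Lemma mpolyX_sub_supp_ideal m : 'X_[m] - 'X_[mesym1 (mnm_supp m)] \in I.
Proof.
have [k] := ubnP (mdeg m); elim: k m => // k IHk m ltmk.
have [m_le1 | /forallPn[i]] := boolP [forall i, m i <= 1]%N.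
  by rewrite mesym1_mnm_supp ?subrr ?rpred0 // => i; apply: (forallP m_le1).
rewrite -ltnNge => m_i.
have le_im : (U_(i) <= m)%MM.
  by apply/mnm_lepP => j; rewrite mnm1E; case: eqP => [<-|//]; apply: ltnW.
have supp_i : mnm_supp (m - U_(i)) = mnm_supp m.
  apply/setP => j; rewrite !inE mnmBE mnm1E.
  case: (eqVneq i j) => [<-|_] /=; last by rewrite subn0.
  by rewrite -!lt0n subn_gt0 m_i ltnW.
rewrite -[X in X \in _](subrKA 'X_[m - U_(i)]) rpredD ?mpolyX_sub_ideal //.
rewrite -supp_i; apply: IHk; move: ltmk.
by rewrite -{1}(submK le_im) mdegD mdeg1 addn1 ltnS.
Qed.

(** An edge inside the support gives a generator $x_i x_j$ dividing the monomial; irreflexivity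
    ensures $i \neq j$, so exponents of 1 suffice. *)
Lemma mpolyX_nonindep_ideal m :
  irreflexive e -> ~~ indep (mnm_supp m) -> 'X_[m] \in I.
Proof.
move=> irr_e /forall_inPn[i]; rewrite inE => mi /forall_inPn[j]; rewrite inE => mj.
rewrite negbK => eij; have le_m : (U_(i) + U_(j) <= m)%MM.
  apply/mnm_lepP => l; rewrite mnmDE !mnm1E.
  have [<-|_] := eqVneq i l; have [jl|_] := eqVneq j _ => //=.
  - by rewrite jl irr_e in eij.
  - by rewrite lt0n.
  - by rewrite -jl lt0n.
rewrite -(submK le_m) !mpolyXD.
exact/mul_absorbing_subproof/mem_ideal_gen/indep_gen_edge.
Qed.

(** The monomial [mesym1 S] divides every monomial of support [S]. If it led [p], it would be the
    only one of that support in [p], and its coefficient would vanish. *)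
Lemma lead_indep_notin_ideal p S : p \in I -> indep S ->
  ~ is_lead_monom (@lex_le N) p (mesym1 S).
Proof.
move=> pI indS [Sp leadS]; have := Sp; rewrite mcoeff_msupp => /eqP; apply.
apply: mcoeff_mesym1_eq0 => // m mp suppm; apply: lex_le_antisym (leadS _ mp) _.
by rewrite -suppm mesym1_supp_le.
Qed.

Lemma standard_monomE m : irreflexive e ->
  standard_monom (@lex_le N) I m =
  [forall i, m i <= 1]%N && indep (mnm_supp m).
Proof.
move=> irr_e; apply/idP/andP => [std_m | [/forallP m_le1 ind_m]].
  split.
    apply: contraLR std_m => /forallPn[i]; rewrite -ltnNge => m_i; rewrite negbK.
    have le_im : (U_(i) <= m)%MM.
      by apply/mnm_lepP => j; rewrite mnm1E; case: eqP => [<-|//]; apply: ltnW.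
    have neq_m : (m - U_(i))%MM != m.
      by apply/eqP => /mnmP/(_ i); rewrite mnmBE mnm1E eqxx; lia.
    (* This binomial lies in the ideal and is led by [m], since its other monomial divides [m]. *)
    apply: mem_ideal_gen; exists ('X_[m] - 'X_[m - U_(i)]), m.
    have coef_m : ('X_[m] - 'X_[m - U_(i)] : {mpoly K[N]})@_m = 1.
      by rewrite mcoeffB !mcoeffX eqxx (negPf neq_m) subr0.
    split=> //; first exact: mpolyX_sub_ideal.
      by apply/eqP => p0; move: coef_m; rewrite p0 mcoeff0 => /esym/eqP; rewrite oner_eq0.
    split; first by rewrite mcoeff_msupp coef_m oner_eq0.
    move=> m' /msuppB_le; rewrite mem_cat !msuppX !inE => /orP[]/eqP->.
      by rewrite /lex_le eqxx.
    by apply: lex_le_mnm; apply/mnm_lepP => j; rewrite mnmBE leq_subr.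
  apply: contraLR std_m => nind_m; rewrite negbK.
  apply: mem_ideal_gen; exists 'X_[m], m; split=> //.
  - exact: mpolyX_nonindep_ideal.
  - by rewrite -msupp_eq0 msuppX.
  - by split=> [|m']; rewrite msuppX !inE // => /eqP->; rewrite /lex_le eqxx.
(* If [m] were in the initial ideal, some leading monomial [m'] would divide it. Then [m'] too would
   be squarefree with independent support, which [lead_indep_notin_ideal] excludes. *)
apply/negP => /asboolP[t t_lead].
move=> /(congr1 (mcoeff m)); rewrite mcoeffX eqxx raddf_sum /=.
rewrite big1_seq; first by apply/eqP; rewrite oner_eq0.
move=> x /andP[_ xt]; have [p [m' [pI _ lead_m' ->]]] := t_lead _ xt.
apply: memN_msupp_eq0; apply/negP => /msuppM_le /allpairsP[[u w]] /=.
rewrite msuppX inE => -[_ /eqP-> def_m].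
have sub_m : (m' <= m)%MM by rewrite def_m; apply/mnm_lepP => i; rewrite mnmDE leq_addl.
exfalso; apply: (@lead_indep_notin_ideal p (mnm_supp m')) => //.
  apply: indep_sub ind_m; apply/fintype.subsetP => i; rewrite !inE -!lt0n => m'i.
  by apply: leq_trans m'i _; apply/mnm_lepP.
by rewrite mesym1_mnm_supp // => i; apply: leq_trans (m_le1 i); apply/mnm_lepP.
Qed.

(** Taking supports is a bijection from the standard monomials of degree [d] to the independent sets
    of size [d], as the former are squarefree. *)
Lemma hilbert_function_indep d : irreflexive e ->
  hilbert_function (@lex_le N) I d = #|[set S | indep S && (#|S| == d)]%SET|.
Proof.
move=> irr_e; rewrite /hilbert_function; symmetry.
have bound_S S : (#|S| == d) -> (mdeg (mesym1 S) < d.+1)%N.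
  by rewrite mdeg_mesym1 => /eqP->.
rewrite -(card_in_imset (f := fun m : 'X_{1..N < d.+1} => mnm_supp m)); last first.
  move=> m1 m2; rewrite !inE !standard_monomE // => /and3P[_ /forallP le1 _].
  move=> /and3P[_ /forallP le2 _] eq12; apply/val_inj => /=.
  by rewrite -[LHS]mesym1_mnm_supp // eq12 mesym1_mnm_supp.
apply: eq_card => S; rewrite !inE; apply/andP/imsetP => [[indS cardS] | [m]].
  exists (BMultinom (bound_S S cardS)); last by rewrite /= mnm_supp_mesym1.
  rewrite inE /= mdeg_mesym1 cardS standard_monomE // mnm_supp_mesym1 indS andbT.
  by apply/forallP => i; rewrite mnmE; case: (i \in S).
rewrite inE standard_monomE // => /and3P[deg_m /forallP le1 indm] ->.
by split=> //; rewrite -mdeg_mesym1 mesym1_mnm_supp.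
Qed.

Lemma quot_class_lincomb d (c : 'I_d -> K) (q : 'I_d -> {mpoly K[N]}) :
  \sum_i c i *: quot_class I (q i) = quot_class I (\sum_i c i *: q i).
Proof.
rewrite (big_morph _ (@quot_classD _ _ I) (raddf0 _)).
by apply: eq_bigr => i _; apply: quot_scaleE.
Qed.

Lemma has_dim_indep : irreflexive e ->
  has_dim (quot_lmod I) #|[set S | indep S]%SET|.
Proof.
move=> irr_e; pose q (i : 'I_#|[set S | indep S]%SET|) : {mpoly K[N]} :=
  'X_[mesym1 (enum_val i)].
(* Spanning is checked monomial by monomial: each is congruent to a basis element or to 0. *)
exists (fun i => quot_class I (q i)); split=> [v | c].
  rewrite -[v]quot_class_repr; move: (repr _) => /= p.
  rewrite [p]mpolyE; elim/big_ind: _ => [|p1 p2 [c1 e1] [c2 e2]|m _].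
  - by exists (fun=> 0); rewrite quot_class_lincomb big1 // => i _; rewrite scale0r.
  - exists (fun i => c1 i + c2 i); rewrite quot_classD e1 e2 -big_split.
    by apply: eq_bigr => i _; rewrite scalerDl.
  have [ind_m | nind_m] := boolP (indep (mnm_supp m)).
    have Sm : mnm_supp m \in [set S | indep S]%SET by rewrite inE.
    exists (fun i => if i == enum_rank_in Sm (mnm_supp m) then p@_m else 0).
    rewrite quot_class_lincomb (bigD1 (enum_rank_in Sm (mnm_supp m))) //= eqxx.
    rewrite big1 ?addr0; last by move=> i /negPf->; rewrite scale0r.
    rewrite /q enum_rankK_in //; apply/quot_class_eqP.
    by rewrite -scalerBr -mulr_algl mul_absorbing_subproof ?mpolyX_sub_supp_ideal.
  exists (fun=> 0); rewrite quot_class_lincomb big1; last by move=> i _; rewrite scale0r.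
  apply/quot_class_eqP; rewrite subr0 -mulr_algl mul_absorbing_subproof //.
  exact: mpolyX_nonindep_ideal.
rewrite quot_class_lincomb => p0.
have pI : \sum_i c i *: q i \in I.
  by rewrite -[X in X \in _]subr0; apply/quot_class_eqP; rewrite p0 [RHS]raddf0.
move=> i; have indi : indep (enum_val i) by have := enum_valP i; rewrite inE.
have <- : (\sum_i c i *: q i)@_(mesym1 (enum_val i)) = c i.
  rewrite raddf_sum (bigD1 i) //= big1 ?addr0 => [|j neq_ji]; last first.
    rewrite mcoeffZ mcoeffX (inj_eq (@inj_mesym1 N)) (inj_eq enum_val_inj).
    by rewrite (negPf neq_ji) mulr0.
  by rewrite mcoeffZ mcoeffX eqxx mulr1.
(* Only squarefree monomials occur in the combination, so each support occurs at most once. *)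
apply: mcoeff_mesym1_eq0 => // m.
move=> /msupp_sum_le /flattenP[_ /mapP[j _ ->]] /msuppZ_le.
by rewrite msuppX inE => /eqP-> <-; rewrite mnm_supp_mesym1.
Qed.

End IndependenceIdeal.

(** * Partial Latin rectangles as independent sets of entries *)

Section PartialLatinRectanglesAsIndependentSets.
Variables r s n : nat.
Implicit Types (P : 'M[option 'I_n]_(r, s)) (S : {set 'I_#|cells r s n|}).

(** The three cases follow the generators [gen_col], [gen_row] and [gen_cell], with the same strict
    inequalities. *)
Definition cell_clash (u v : cells r s n) : bool :=
  [|| [&& u.1.1 < v.1.1, u.1.2 == v.1.2 & u.2 == v.2],
      [&& u.1.1 == v.1.1, u.1.2 < v.1.2 & u.2 == v.2]
    | [&& u.1.1 == v.1.1, u.1.2 == v.1.2 & u.2 < v.2]]%N.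

Definition plr_clash : rel 'I_#|cells r s n| :=
  fun u v => cell_clash (enum_val u) (enum_val v).

Lemma plr_clash_irr : irreflexive plr_clash.
Proof. by move=> u; rewrite /plr_clash /cell_clash !ltnn !andbF. Qed.

(** Stated as an equality of predicates, so that rewriting carries the whole theorem over to the
    graph ideal. *)
Lemma plr_generatorE : @plr_generator r s n = @indep_generator _ _ plr_clash.
Proof.
apply/funext => p; apply/propext; split.
  have clash_gen (u v : cells r s n) : cell_clash u v ->
      @indep_generator 'F_2 _ plr_clash ('X_(enum_rank u) * 'X_(enum_rank v)).
    by move=> uv; apply: indep_gen_edge; rewrite /plr_clash !enum_rankK.
  case=> [i j k|i i' j k lt|i j j' k lt|i j k k' lt]; first exact: indep_gen_bool.
  - by apply: clash_gen; rewrite /cell_clash /= lt !eqxx.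
  - by apply: clash_gen; rewrite /cell_clash /= lt !eqxx orbT.
  - by apply: clash_gen; rewrite /cell_clash /= lt !eqxx !orbT.
case=> [u|u v].
  rewrite -(enum_valK u); case: (enum_val u) => [[i j] k].
  exact: (gen_bool i j k).
rewrite /plr_clash -{2}(enum_valK u) -{2}(enum_valK v).
case: (enum_val u) (enum_val v) => [[i j] k] [[i' j'] k'] /or3P[]/and3P[] /=.
- by move=> lt /eqP<- /eqP<-; apply: gen_col.
- by move=> /eqP<- lt /eqP<-; apply: gen_row.
- by move=> /eqP<- /eqP<- lt; apply: gen_cell.
Qed.

Definition plr_supp P : {set 'I_#|cells r s n|} :=
  [set v | P (enum_val v).1.1 (enum_val v).1.2 == Some (enum_val v).2]%SET.

Lemma mem_plr_supp P i j k :
  (enum_rank ((i, j, k) : cells r s n) \in plr_supp P) = (P i j == Some k).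
Proof. by rewrite inE enum_rankK. Qed.

Lemma plr_supp_inj : injective plr_supp.
Proof.
move=> P Q eqPQ; apply/matrixP => i j.
have eqk k : (P i j == Some k) = (Q i j == Some k) by rewrite -!mem_plr_supp eqPQ.
case Pij: (P i j) => [k|]; first by apply/esym/eqP; rewrite -eqk Pij.
by case Qij: (Q i j) => [k|//]; have := eqk k; rewrite Pij Qij eqxx.
Qed.

Lemma is_plrP P : reflect
  ((forall i j j' k, P i j = Some k -> P i j' = Some k -> j = j') /\
   (forall i i' j k, P i j = Some k -> P i' j = Some k -> i = i'))
  (is_plr P).
Proof.
apply: (iffP forallP) => [plrP | [rowP colP] k].
  split=> [i j j' k Pj Pj' | i i' j k Pi Pi'].
    have /andP[/forallP/(_ i)/card_le1_eqP row_le1 _] := plrP k.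
    by apply: row_le1; rewrite inE ?Pj ?Pj'.
  have /andP[_ /forallP/(_ j)/card_le1_eqP col_le1] := plrP k.
  by apply: col_le1; rewrite inE ?Pi ?Pi'.
apply/andP; split; apply/forallP => x; apply/card_le1_eqP => y z;
  rewrite !inE => /eqP Py /eqP Pz; [exact: rowP Pz Py | exact: colP Pz Py].
Qed.

Lemma indep_plr_supp P : indep plr_clash (plr_supp P) = is_plr P.
Proof.
apply/indepP/is_plrP => [indP | [rowP colP] u v].
  have no_clash i j k i' j' k' : P i j = Some k -> P i' j' = Some k' ->
      ~~ cell_clash (i, j, k) (i', j', k').
    move=> Pk Pk'; rewrite -(enum_rankK (i, j, k)) -(enum_rankK (i', j', k')).
    by apply: indP; rewrite mem_plr_supp ?Pk ?Pk'.
  split=> [i j j' k Pk Pk' | i i' j k Pk Pk']; apply/val_inj => /=.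
    (* The clash is oriented; excluding it in both orders leaves only equal indices. *)
    have := no_clash _ _ _ _ _ _ Pk Pk'; have := no_clash _ _ _ _ _ _ Pk' Pk.
    by rewrite /cell_clash /= !eqxx !ltnn; case: ltngtP; rewrite //= ?orbT ?andbT.
  have := no_clash _ _ _ _ _ _ Pk Pk'; have := no_clash _ _ _ _ _ _ Pk' Pk.
  by rewrite /cell_clash /= !eqxx !ltnn; case: ltngtP; rewrite //= ?orbT ?andbT.
rewrite !inE /plr_clash.
case: (enum_val u) (enum_val v) => [[i j] k] [[i' j'] k'] /= /eqP Pu /eqP Pv.
apply/negP => /or3P[]/and3P[] /=.
- move=> lt /eqP ej /eqP ek; subst j' k'.
  by rewrite (colP _ _ _ _ Pu Pv) ltnn in lt.
- move=> /eqP ei lt /eqP ek; subst i' k'.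
  by rewrite (rowP _ _ _ _ Pu Pv) ltnn in lt.
(* Two symbols in one cell: impossible because [P i j] has a single value. *)
- move=> /eqP ei /eqP ej lt; subst i' j'.
  by move: Pv; rewrite Pu => -[ek]; rewrite ek ltnn in lt.
Qed.

Lemma indep_plr_supp_onto S : indep plr_clash S -> exists P, plr_supp P = S.
Proof.
move=> /indepP indS.
pose P : 'M[option 'I_n]_(r, s) :=
  \matrix_(i, j) [pick k | enum_rank ((i, j, k) : cells r s n) \in S].
exists P; apply/setP => v; rewrite inE -{4}(enum_valK v).
have : enum_rank (enum_val v) \in S = (v \in S) by rewrite enum_valK.
case: (enum_val v) => [[i j] k] /= _; rewrite mxE.
(* Independence allows at most one symbol per cell, so the picked [k'] is the only candidate. *)
case: pickP => [k' Sk' | noS]; last by rewrite noS.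
apply/eqP/idP => [[<-] // | Sk]; congr Some; apply/val_inj => /=.
have := indS _ _ Sk Sk'; have := indS _ _ Sk' Sk.
rewrite /plr_clash !enum_rankK /cell_clash /= !eqxx !ltnn /=.
by case: ltngtP.
Qed.

(** Sending an entry to its cell is injective on [plr_supp P], with the filled cells as image. *)
Lemma plr_size_supp P : plr_size P = #|plr_supp P|.
Proof.
rewrite -(card_in_imset (f := fun v => (enum_val v).1)) => [|u v].
  apply: eq_card => -[i j]; rewrite inE /=; apply/idP/imsetP => [|[v]].
    case Pij: (P i j) => [k|] // _.
    by exists (enum_rank ((i, j, k) : cells r s n)); rewrite ?mem_plr_supp ?Pij ?enum_rankK.
  by rewrite inE; case: (enum_val v) => [[i' j'] k] /= /eqP Pk [-> ->]; rewrite Pk.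
rewrite !inE => Pu Pv eq1; apply: enum_val_inj; move: Pu Pv eq1.
case: (enum_val u) (enum_val v) => [[i j] k] [[i' j'] k'] /= /eqP Pu /eqP Pv [ei ej].
by subst i' j'; move: Pu; rewrite Pv => -[->].
Qed.

(** The predicate [f] serves both counts: always true for the dimension, equality with [m] for the
    Hilbert function. *)
Lemma card_plr_by_size (f : pred nat) :
  #|[set P in PLR r s n | f (plr_size P)]%SET| =
  #|[set S | indep plr_clash S && f #|S|]%SET|.
Proof.
rewrite -(card_imset _ plr_supp_inj); apply: eq_card => S.
rewrite inE; apply/imsetP/andP => [[P] | [indS fS]].
  by rewrite !inE => /andP[plrP fP] ->; rewrite indep_plr_supp -plr_size_supp.
have [P SP] := indep_plr_supp_onto indS.
by exists P; rewrite // !inE plr_size_supp -indep_plr_supp SP indS.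
Qed.

Lemma plr_point_supp P (v : 'I_#|cells r s n|) :
  plr_point P (enum_val v) = indicator 'F_2 (plr_supp P) v.
Proof. by rewrite ffunE /indicator inE. Qed.

End PartialLatinRectanglesAsIndependentSets.

(** * Zeros, dimension and Hilbert function for partial Latin rectangles *)

Theorem theorem2 (r s n : nat) (r_gt0 : (0 < r)%N) (s_gt0 : (0 < s)%N)
    (n_gt0 : (0 < n)%N) :
  [/\ set_bij [set P | P \in PLR r s n]%classic (zeros (plr_ideal r s n))
        (@plr_point r s n),
      has_dim (quot_lmod (plr_ideal r s n)) #|PLR r s n|
    & forall m : nat,
        #|PLR_size r s n m| =
        hilbert_function (@lex_le #|cells r s n|) (plr_ideal r s n) m].
Proof.
rewrite /plr_ideal plr_generatorE; split; last first.
- move=> m; rewrite hilbert_function_indep; last exact: plr_clash_irr.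
  exact: card_plr_by_size (fun k => k == m).
- have -> : #|PLR r s n| = #|[set S | indep (@plr_clash r s n) S]%SET|.
    transitivity #|[set P in PLR r s n | predT (plr_size P)]%SET|.
      by apply: eq_card => P; rewrite !inE andbT.
    by rewrite card_plr_by_size; apply: eq_card => S; rewrite !inE andbT.
  exact/has_dim_indep/plr_clash_irr.
split=> [P | P Q _ _ eqPQ | a a0].
- rewrite /= inE => plrP p pI.
  rewrite (meval_eq (v2 := indicator 'F_2 (plr_supp P))); last exact: plr_point_supp.
  by apply: indicator_zero pI; rewrite indep_plr_supp.
- apply/plr_supp_inj/setP => v; have := congr1 (fun a : {ffun _} => a (enum_val v)) eqPQ.
  rewrite !plr_point_supp /indicator.
  by do 2!case: (v \in _).
(* Surjectivity: a common zero is the 0/1 indicator of an independent set, which is the entry set of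
   some [P]. *)
have [a01 ind_a] := (indep_ideal_zeroP _ _).1 a0.
have [P suppP] := indep_plr_supp_onto ind_a.
exists P; first by rewrite /= inE -indep_plr_supp suppP.
apply/ffunP => u; rewrite -(enum_rankK u) plr_point_supp suppP /indicator inE.
by case/orP: (a01 (enum_rank u)) => /eqP->.
Qed.
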